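(* There exist universal constants $C,c>0$ such that for every $n\ge 1$, every $f:\{-1,1\}^n\to\{-1,1\}$ and every $\varepsilon\in[0,1]$, $$S_\varepsilon(f)\le C\cdot\mathrm{Var}(f)\left(\sum_{i=1}^n\mathrm{Inf}_i(f)^2\right)^{c\varepsilon}.$$
   Context: $\mu$ is the uniform probability measure on $\{-1,1\}^n$; $\mathrm{Var}$ is taken with respect to $\mu$. $y^{\oplus i}$ is $y$ with the $i$-th coordinate flipped. $\mathrm{Inf}_i(f)=\mu(\{y: f(y)\ne f(y^{\oplus i})\})$. The noise stability is $S_\varepsilon(f)=\mathrm{Cov}_{x\sim\mu,\,y\sim N_\varepsilon(x)}[f(x),f(y)]$, where $N_\varepsilon(x)$ is a random vector whose coordinates are independent (given $x$), the $i$-th coordinate being equal to $x_i$ with probability $1-\varepsilon$ and to an independent uniformly random bit in $\{-1,1\}$ with probability $\varepsilon$. *)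

(* Defs.v *)
From mathcomp Require Import all_boot all_order all_algebra.
From mathcomp Require Import reals exp.

Set Implicit Arguments.
Unset Strict Implicit.
Unset Printing Implicit Defensive.

Import Order.TTheory GRing.Theory Num.Theory.

Local Open Scope ring_scope.

(* Finite probability spaces, given by a mass function [p : T -> R].          *)

Definition pr (R : realType) (T : finType) (p : T -> R) (A : {set T}) : R :=
  \sum_(x in A) p x.

Definition mean (R : realType) (T : finType) (p g : T -> R) : R :=
  \sum_x p x * g x.

Definition cov (R : realType) (T : finType) (p g h : T -> R) : R :=
  mean p (fun x => (g x - mean p g) * (h x - mean p h)).

Definition var (R : realType) (T : finType) (p g : T -> R) : R := cov p g g.

(* The cube {-1,1}^n, a coordinate [b : bool] standing for the sign (-1)^b.   *)
Definition cube (n : nat) : finType := {ffun 'I_n -> bool}.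

Definition flip (n : nat) (i : 'I_n) (y : cube n) : cube n :=
  [ffun j => if j == i then ~~ y j else y j].

Definition mu (R : realType) (n : nat) (x : cube n) : R := #|cube n|%:R^-1.
Arguments mu R n x : clear implicits.

Definition Inf (R : realType) (n : nat) (f : cube n -> R) (i : 'I_n) : R :=
  pr (mu R n) [set y | f y != f (flip i y)].

(* The law of one coordinate of N_eps(x): the mixture of the point mass at    *)
(* [a] (weight 1 - eps) and of the uniform law on two points (weight eps).    *)
Definition noise_bit (R : realType) (eps : R) (a b : bool) : R :=
  (1 - eps) * (b == a)%:R + eps * 2^-1.

(* The probability that N_eps(x) = y; coordinates are independent given x.    *)
Definition noise (R : realType) (n : nat) (eps : R) (x y : cube n) : R :=
  \prod_(i < n) noise_bit eps (x i) (y i).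

(* The joint law of (x, y) with x ~ mu and y ~ N_eps(x).                      *)
Definition noisy_pair (R : realType) (n : nat) (eps : R)
    (xy : cube n * cube n) : R :=
  mu R n xy.1 * noise eps xy.1 xy.2.

Definition stability (R : realType) (n : nat) (eps : R) (f : cube n -> R) : R :=
  cov (noisy_pair eps) (fun xy => f xy.1) (fun xy => f xy.2).

(* Main.v *)
Require Import Defs.
From mathcomp Require Import all_boot all_order all_algebra.
From mathcomp Require Import reals exp.
From mathcomp Require Import ring lra.

Set Implicit Arguments.
Unset Strict Implicit.
Unset Printing Implicit Defensive.

Import Order.TTheory GRing.Theory Num.Theory.

Local Open Scope ring_scope.

(** Write [g = f - E f], let [V = E g^2] be the variance of [f], put
    [W = \sum_i Inf_i(f)^2], and let [energy r g] be the sum over all sets [S]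
    of [r ^ #|S| * ghat(S)^2], where [ghat] are the Fourier coefficients of [g]
    (the empty set contributes 0, since [g] is centred).  Expanding the noise
    kernel in characters shows that the stability of [f] at noise [eps] is
    [energy (1 - eps) g].  The constants obtained are [C = 1] and [c = 1/8].

    All the analysis happens at the single rate [r = 1/3], where Bonami's
    inequality (fourth moments against second moments) gives, by duality and
    Cauchy-Schwarz, the estimate [energy (1/3) h <= E|h| * sqrt (E h^2)] for
    every [h] ([hypercontractivity]).  It is used twice.

    - With [h = g]: since [f] is valued in {-1, 1}, [E|g| = V], whence
      [energy (1/3) g <= V^(3/2)].
    - With [h = d_i], the increments of the martingale that reveals the
      coordinates one at a time: [d_i] is the part of the Fourier expansion
      carried by the sets whose largest element is [i].  Every nonempty set has
      exactly one largest element, so both the energy of [g] at rate [1/3] and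
      its variance are the sums of those of the [d_i].  Moreover [d_i] is a
      conditional expectation of the discrete derivative of [f] in direction
      [i], whence [E|d_i| <= Inf_i(f)].  Cauchy-Schwarz over [i] yields
      [energy (1/3) g <= sqrt (W * V)] ([energy_le_influences]), with no loss
      when the total influence is large.

    The geometric mean of the two bounds is [energy (1/3) g <= V * W^(1/4)].
    Finally [1 - eps <= (1/3)^(eps/2)], so Jensen's inequality for the concave
    function [x^(eps/2)] and the spectral weights [ghat(S)^2 / V] gives
    [energy (1 - eps) g <= V * (energy (1/3) g / V)^(eps/2)]
    ([energy_interpolation]), which is at most [V * W^(eps/8)]. *)

(** * Cauchy-Schwarz and finite means *)

Section Mean.
Variable R : realType.

(** Cauchy-Schwarz with [sqrt (a i)] and [sqrt (b i)] as the two vectors,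
    phrased without square roots so that the bounds can be multiplied and
    compared by polynomial arithmetic. *)
Lemma sqr_sum_le (I : finType) (a b c : I -> R) :
  (forall i, 0 <= a i) -> (forall i, 0 <= b i) ->
  (forall i, c i ^+ 2 <= a i * b i) ->
  (\sum_i c i) ^+ 2 <= (\sum_i a i) * (\sum_i b i).
Proof.
move=> a0 b0 cab.
rewrite expr2 !big_distrlr /=.
suff H : \sum_i \sum_j c i * c j
    <= \sum_i \sum_j (a i * b j + a j * b i) / 2.
  apply: (le_trans H); rewrite le_eqVlt; apply/orP; left; apply/eqP.
  transitivity ((\sum_i \sum_j a i * b j + \sum_i \sum_j a j * b i) / 2).
    rewrite -big_split /= mulr_suml; apply: eq_bigr => i _.
    by rewrite -big_split /= mulr_suml.
  rewrite [X in (_ + X) / 2]exchange_big /=; by field.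
apply: ler_sum => i _; apply: ler_sum => j _.
(* the product [(c i * c j)^2] is at most [(a i * b j) * (a j * b i)]: AM-GM *)
have ab i' j' : 0 <= a i' * b j' by rewrite mulr_ge0.
apply: (le_trans (ler_norm _)).
rewrite -ler_sqr ?nnegrE ?normr_ge0 //; last first.
  by rewrite divr_ge0 // addr_ge0.
rewrite real_normK ?num_real // exprMn.
apply: (@le_trans _ _ ((a i * b j) * (a j * b i))).
  rewrite (_ : _ * _ = (a i * b i) * (a j * b j)); last ring.
  by apply: ler_pM => //; exact: sqr_ge0.
move: (sqr_ge0 (a i * b j - a j * b i)); nra.
Qed.

Lemma mean_sqr_le (T : finType) (p : T -> R) (a b c : T -> R) :
  (forall x, 0 <= p x) -> (forall x, 0 <= a x) -> (forall x, 0 <= b x) ->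
  (forall x, c x ^+ 2 <= a x * b x) ->
  mean p c ^+ 2 <= mean p a * mean p b.
Proof.
move=> p0 a0 b0 cab; apply: sqr_sum_le => x; rewrite ?mulr_ge0 //.
rewrite exprMn expr2 (_ : p x * a x * _ = p x * p x * (a x * b x)); last ring.
by rewrite ler_wpM2l // mulr_ge0.
Qed.

Lemma eq_mean (T : finType) (p g h : T -> R) : g =1 h -> mean p g = mean p h.
Proof. by move=> gh; apply: eq_bigr => x _; rewrite gh. Qed.

Lemma ler_mean (T : finType) (p g h : T -> R) :
  (forall x, 0 <= p x) -> (forall x, g x <= h x) -> mean p g <= mean p h.
Proof. by move=> p0 gh; apply: ler_sum => x _; rewrite ler_wpM2l. Qed.

Lemma mean_ge0 (T : finType) (p g : T -> R) :
  (forall x, 0 <= p x) -> (forall x, 0 <= g x) -> 0 <= mean p g.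
Proof. by move=> p0 g0; apply: sumr_ge0 => x _; rewrite mulr_ge0. Qed.

Lemma meanD (T : finType) (p g h : T -> R) :
  mean p (fun x => g x + h x) = mean p g + mean p h.
Proof. by rewrite -big_split; apply: eq_bigr => x _; rewrite mulrDr. Qed.

Lemma meanZ (T : finType) (p g : T -> R) (c : R) :
  mean p (fun x => c * g x) = c * mean p g.
Proof. by rewrite mulr_sumr; apply: eq_bigr => x _; rewrite mulrCA. Qed.

Lemma mean_sum (T I : finType) (p : T -> R) (P : pred I) (g : I -> T -> R) :
  mean p (fun x => \sum_(i | P i) g i x) = \sum_(i | P i) mean p (g i).
Proof.
rewrite /mean exchange_big; apply: eq_bigr => x _; exact: mulr_sumr.
Qed.

End Mean.

(** * Fourier analysis on the cube *)

Section Cube.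
Variables (R : realType) (n : nat).
Notation E := (mean (mu R n)).

Lemma flipK (i : 'I_n) : involutive (@flip n i).
Proof.
move=> x; apply/ffunP => j; rewrite !ffunE.
by case: eqP => // _; rewrite negbK.
Qed.

Lemma card_cube_gt0 : 0 < #|cube n|%:R :> R.
Proof. by rewrite ltr0n; apply/card_gt0P; exists [ffun=> true]. Qed.

Lemma mu_ge0 (x : cube n) : 0 <= mu R n x.
Proof. by rewrite invr_ge0 ltW // card_cube_gt0. Qed.

Lemma mean_cst (c : R) : E (fun=> c) = c.
Proof.
rewrite /mean -mulr_suml sumr_const -[_ *+ _]mulr_natr mulVf ?mul1r //.
by rewrite gt_eqF // card_cube_gt0.
Qed.

Lemma mean_flip (i : 'I_n) (g : cube n -> R) : E (fun x => g (flip i x)) = E g.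
Proof. by rewrite /mean [RHS](reindex_inj (inv_inj (flipK i))). Qed.

Definition character (S : {set 'I_n}) (x : cube n) : R :=
  \prod_(i in S) (-1) ^+ x i.

Definition coef (g : cube n -> R) (S : {set 'I_n}) : R :=
  E (fun x => g x * character S x).

(** For [r] in [0, 1] this is the inner product of [g] with its image under
    the noise operator of correlation [r]; [r = 1] is the second moment. *)
Definition energy (r : R) (g : cube n -> R) : R :=
  \sum_(S : {set 'I_n}) r ^+ #|S| * coef g S ^+ 2.

Lemma character_flip (i : 'I_n) S x :
  character S (flip i x) = (-1) ^+ (i \in S) * character S x.
Proof.
rewrite /character; case: (boolP (i \in S)) => iS.
  rewrite (big_setD1 i) //= [in RHS](big_setD1 i) //= mulrA.
  rewrite /flip ffunE eqxx signrN expr1 mulN1r; congr (_ * _).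
  apply: eq_bigr => j; rewrite !inE => /andP[ji _].
  by rewrite ffunE (negbTE ji).
rewrite mul1r; apply: eq_bigr => j jS; rewrite ffunE.
by case: eqP => // ji; rewrite -ji jS in iS.
Qed.

(** One coordinate of the kernel is [(1 + (1 - eps) a b) / 2] in signs [a],
    [b]; expanding the product over coordinates produces the characters. *)
Lemma noise_expansion (eps : R) (x y : cube n) :
  noise eps x y
  = mu R n y * \sum_(S : {set 'I_n})
      (1 - eps) ^+ #|S| * (character S x * character S y).
Proof.
have bitE a b : noise_bit eps a b
    = 2^-1 * ((1 - eps) * ((-1) ^+ a * (-1) ^+ b) + 1).
  by rewrite /noise_bit; case: a b => [] [] /=; field.
rewrite /noise (eq_bigr _ (fun i _ => bitE (x i) (y i))) big_split /=.
congr (_ * _).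
  rewrite prodr_const card_ord /mu card_ffun card_bool card_ord.
  by rewrite natrX exprVn.
rewrite bigA_distr; apply: eq_bigr => S _.
rewrite -big_mkcond /= !big_split /= prodr_const.
by [].
Qed.

Lemma noise0 (x y : cube n) : noise 0 x y = (x == y)%:R :> R.
Proof.
rewrite /noise; case: eqP => [->|xy].
  by apply: big1 => i _; rewrite /noise_bit eqxx subr0 mul0r addr0 mul1r.
have [i xyi] : exists i, y i != x i.
  apply/existsP; apply: contraNT (introN eqP xy) => /existsPn xyE.
  by apply/eqP/ffunP => i; apply/esym/eqP/negPn/xyE.
rewrite (bigD1 i) //= /noise_bit (negbTE xyi).
by rewrite mulr0 mul0r addr0 mul0r.
Qed.

(** At zero noise the kernel is the point mass, so its expansion is the
    completeness of the characters; this replaces their orthogonality. *)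
Lemma coef_inversion (g : cube n -> R) (x : cube n) :
  \sum_S coef g S * character S x = g x.
Proof.
transitivity (\sum_y g y * noise 0 x y).
  under eq_bigr => S _ do rewrite /coef /mean mulr_suml.
  rewrite exchange_big; apply: eq_bigr => y _ /=.
  rewrite noise_expansion mulrCA mulr_sumr mulr_sumr.
  by apply: eq_bigr => S _; rewrite subr0 expr1n; ring.
rewrite (bigD1 x) //= noise0 eqxx mulr1 big1 ?addr0 // => y yx.
by rewrite noise0 eq_sym (negbTE yx) mulr0.
Qed.

Lemma mean_mul_expansion (g : cube n -> R) (a : {set 'I_n} -> R) :
  E (fun x => g x * \sum_S a S * character S x) = \sum_S a S * coef g S.
Proof.
under [LHS]eq_mean => x do rewrite mulr_sumr.
rewrite mean_sum.
apply: eq_bigr => S _; rewrite -meanZ.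
by apply: eq_mean => x; rewrite mulrCA.
Qed.

Lemma parseval (g : cube n -> R) : E (fun x => g x ^+ 2) = \sum_S coef g S ^+ 2.
Proof.
rewrite -mean_mul_expansion.
by apply: eq_mean => x; rewrite coef_inversion.
Qed.

Lemma noise_energy (eps : R) (g : cube n -> R) :
  mean (noisy_pair eps) (fun xy => g xy.1 * g xy.2) = energy (1 - eps) g.
Proof.
transitivity (\sum_x \sum_y mu R n x * noise eps x y * (g x * g y)).
  by rewrite pair_big.
under eq_bigr => x _ do under eq_bigr => y _ do
  rewrite noise_expansion mulr_sumr mulr_sumr mulr_suml.
under eq_bigr => x _ do rewrite exchange_big.
rewrite exchange_big; apply: eq_bigr => S _ /=.
rewrite expr2 /coef /mean big_distrlr mulr_sumr; apply: eq_bigr => x _ /=.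
by rewrite mulr_sumr; apply: eq_bigr => y _; ring.
Qed.

(** * Hypercontractivity *)

Lemma sum_set_split (j : 'I_n) (F : {set 'I_n} -> R) :
  \sum_S F S = \sum_(S : {set 'I_n} | j \notin S) (F S + F (j |: S)).
Proof.
rewrite (bigID (fun S : {set 'I_n} => j \in S)) /= addrC big_split.
congr (_ + _).
rewrite (reindex_onto (fun S => j |: S) (fun S => S :\ j)) /=; last first.
  by move=> S jS; rewrite setD1K.
apply: eq_bigl => S; rewrite setU11 /=.
apply/eqP/idP => [<-|jS]; first by rewrite !inE eqxx.
by rewrite setU1K.
Qed.

(** Induction on the coordinates met by the supporting sets.  Write the sum as
    [u + x_j v] with [u], [v] independent of [x_j]: the odd powers of [x_j]
    average out, the cross term is bounded by Cauchy-Schwarz, and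
    [p^2 + 6 p q + q^2 <= (p + 3 q)^2] closes the step; the latter is where the
    factor 3 comes from. *)
Lemma bonami (a : {set 'I_n} -> R) :
  E (fun x => (\sum_S a S * character S x) ^+ 4)
    <= (\sum_(S : {set 'I_n}) 3 ^+ #|S| * a S ^+ 2) ^+ 2.
Proof.
have [s] : exists s : seq 'I_n, forall S, a S != 0 -> {subset S <= s}.
  by exists (enum 'I_n) => S _ i _; rewrite mem_enum.
elim: s a => [|j s IH] a supp.
  have a0 S : S != set0 -> a S = 0.
    case/set0Pn => i iS; apply/eqP/negPn/negP => /supp/(_ i iS).
    by rewrite in_nil.
  have E0 (F : {set 'I_n} -> R) : (forall S, a S = 0 -> F S = 0) ->
      \sum_S F S = F set0.
    move=> F0; rewrite (bigD1 set0) //= big1 ?addr0 // => S /a0; exact: F0.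
  have aE x : \sum_S a S * character S x = a set0.
    by rewrite E0 => [|S ->]; rewrite ?mul0r // /character big_set0 mulr1.
  under eq_mean => x do rewrite aE.
  rewrite mean_cst E0 => [|S ->]; last by rewrite expr0n mulr0.
  by rewrite cards0 mul1r -exprM.
pose u x := \sum_(S : {set 'I_n}) (if j \in S then 0 else a S) * character S x.
pose v x := \sum_(S : {set 'I_n})
  (if j \in S then 0 else a (j |: S)) * character S x.
have splitE F G : \sum_(S : {set 'I_n}) (if j \in S then 0 else F S) * G S
    = \sum_(S : {set 'I_n} | j \notin S) F S * G S :> R.
  rewrite [RHS]big_mkcond; apply: eq_bigr => S _.
  by case: (j \in S); rewrite ?mul0r.
pose p := \sum_(S : {set 'I_n}) 3 ^+ #|S| * (if j \in S then 0 else a S) ^+ 2.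
pose q := \sum_(S : {set 'I_n})
  3 ^+ #|S| * (if j \in S then 0 else a (j |: S)) ^+ 2.
have uv x : \sum_S a S * character S x = u x + (-1) ^+ x j * v x.
  rewrite (sum_set_split j) /u /v !splitE mulr_sumr -big_split.
  apply: eq_bigr => S jS /=; congr (_ + _).
  by rewrite {1}/character big_setU1 //= mulrCA.
have pq : \sum_(S : {set 'I_n}) 3 ^+ #|S| * a S ^+ 2 = p + 3 * q.
  have sq F : \sum_(S : {set 'I_n})
        3 ^+ #|S| * (if j \in S then 0 else F S) ^+ 2
      = \sum_(S : {set 'I_n} | j \notin S) 3 ^+ #|S| * F S ^+ 2 :> R.
    rewrite [RHS]big_mkcond; apply: eq_bigr => S _.
    by case: (j \in S); rewrite ?expr0n ?mulr0.
  rewrite (sum_set_split j) /p /q !sq mulr_sumr -big_split.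
  apply: eq_bigr => S jS /=; rewrite cardsU1 jS exprD expr1; ring.
have Hu : E (fun x => u x ^+ 4) <= p ^+ 2.
  apply: IH => S; case: ifP => jS; first by rewrite eqxx.
  move=> aS i iS; have := supp S aS i iS; rewrite inE.
  by case: eqP => // ij; rewrite -ij iS in jS.
have Hv : E (fun x => v x ^+ 4) <= q ^+ 2.
  apply: IH => S; case: ifP => jS; first by rewrite eqxx.
  move=> aS i iS; have := supp _ aS i; rewrite !inE iS orbT => /(_ isT).
  by case: eqP => // ij; rewrite -ij iS in jS.
have p0 : 0 <= p.
  by apply: sumr_ge0 => S _; rewrite mulr_ge0 ?sqr_ge0 // exprn_ge0.
have q0 : 0 <= q.
  by apply: sumr_ge0 => S _; rewrite mulr_ge0 ?sqr_ge0 // exprn_ge0.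
have Huv : E (fun x => u x ^+ 2 * v x ^+ 2) <= p * q.
  rewrite -ler_sqr ?nnegrE ?mulr_ge0 //; last first.
    by apply: mean_ge0 => x; [exact: mu_ge0 | rewrite -exprMn sqr_ge0].
  apply: (@le_trans _ _ (E (fun x => u x ^+ 4) * E (fun x => v x ^+ 4))).
    apply: mean_sqr_le => x; rewrite ?mu_ge0 ?exprn_even_ge0 //.
    by rewrite exprMn -!exprM.
  rewrite exprMn; apply: ler_pM => //;
  by apply: mean_ge0 => x; rewrite ?mu_ge0 ?exprn_even_ge0.
have flipE F x : \sum_(S : {set 'I_n})
      (if j \in S then 0 else F S) * character S (flip j x)
    = \sum_(S : {set 'I_n}) (if j \in S then 0 else F S) * character S x.
  apply: eq_bigr => S _; rewrite character_flip.
  by case: (j \in S); rewrite ?mul0r // mul1r.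
have -> : E (fun x => (\sum_S a S * character S x) ^+ 4)
    = E (fun x => u x ^+ 4) + 6 * E (fun x => u x ^+ 2 * v x ^+ 2)
      + E (fun x => v x ^+ 4).
  rewrite -meanZ -!meanD; under [LHS]eq_mean => x do rewrite uv.
  set F := fun x => _ ^+ 4.
  (* averaging over the flip of coordinate j removes the odd terms *)
  transitivity (E (fun x => 2^-1 * (F x + F (flip j x)))).
    by rewrite meanZ meanD mean_flip; field.
  apply: eq_mean => x; rewrite /F /u /v !flipE -/(u x) -/(v x) ffunE eqxx.
  by case: (x j) => /=; field.
rewrite pq; move: Hu Hv Huv p0 q0; nra.
Qed.

Lemma energy_ge0 (r : R) (g : cube n -> R) : 0 <= r -> 0 <= energy r g.
Proof.
by move=> r0; apply: sumr_ge0 => S _; rewrite mulr_ge0 ?sqr_ge0 ?exprn_ge0.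
Qed.

Lemma energy1 (g : cube n -> R) : energy 1 g = E (fun x => g x ^+ 2).
Proof. by rewrite parseval; apply: eq_bigr => S _; rewrite expr1n mul1r. Qed.

(** The dual form of [bonami].  With [u] the image of [g] under noise of
    correlation 1/3, [Q = energy 3^-1 g] equals [E (g u)], and [bonami] reads
    [E u^4 <= Q^2].  Splitting [|g u|] as [|g|^(1/2) * (|g|^(1/2) |u|)] and then
    [|g| u^2] as [|g|] times [u^2], two uses of Cauchy-Schwarz give
    [Q^4 <= (E|g|)^2 * E g^2 * E u^4]; cancel [Q^2]. *)
Lemma hypercontractivity (g : cube n -> R) :
  energy 3^-1 g ^+ 2 <= E (fun x => `|g x|) ^+ 2 * E (fun x => g x ^+ 2).
Proof.
pose u x := \sum_(S : {set 'I_n}) (3^-1 ^+ #|S| * coef g S) * character S x.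
set Q := energy 3^-1 g; set A := E _; set B := E _.
have Q0 : 0 <= Q by apply: energy_ge0; rewrite invr_ge0.
have A0 : 0 <= A by apply: mean_ge0 => x; [exact: mu_ge0 | exact: normr_ge0].
have B0 : 0 <= B by apply: mean_ge0 => x; [exact: mu_ge0 | exact: sqr_ge0].
have QE : E (fun x => g x * u x) = Q.
  rewrite mean_mul_expansion; apply: eq_bigr => S _.
  by rewrite -mulrA -expr2.
have U4 : E (fun x => u x ^+ 4) <= Q ^+ 2.
  apply: le_trans (bonami _) _; rewrite le_eqVlt; apply/orP; left; apply/eqP.
  congr (_ ^+ 2); apply: eq_bigr => S _.
  rewrite exprVn; have : 3 ^+ #|S| != 0 :> R by rewrite expf_neq0 ?pnatr_eq0.
  by move: (3 ^+ #|S|) => z z0; field.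
pose M := E (fun x => `|g x| * u x ^+ 2).
have QM : Q ^+ 2 <= A * M.
  rewrite -QE; apply: mean_sqr_le => x; rewrite ?mu_ge0 ?normr_ge0 //.
    by rewrite mulr_ge0 // sqr_ge0.
  by rewrite exprMn [leRHS]mulrA -expr2 real_normK // num_real.
have MB : M ^+ 2 <= B * E (fun x => u x ^+ 4).
  apply: mean_sqr_le => x; rewrite ?mu_ge0 ?exprn_even_ge0 //.
  by rewrite exprMn real_normK ?num_real // -exprM.
have M0 : 0 <= M.
  by apply: mean_ge0 => x; [exact: mu_ge0 | rewrite mulr_ge0 // sqr_ge0].
have Q4 : Q ^+ 2 * Q ^+ 2 <= (A ^+ 2 * B) * Q ^+ 2.
  apply: (@le_trans _ _ ((A * M) * (A * M))).
    by apply: ler_pM; rewrite ?sqr_ge0.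
  rewrite (_ : _ * _ = A ^+ 2 * M ^+ 2); last ring.
  rewrite -mulrA ler_wpM2l ?sqr_ge0 //.
  by apply: le_trans MB _; rewrite ler_wpM2l.
have [Qp|Qn] := ltP 0 Q; first by rewrite -(ler_pM2r (exprn_gt0 2 Qp)).
have -> : Q = 0 by apply/eqP; rewrite eq_le Qn.
by rewrite expr0n mulr_ge0 // sqr_ge0.
Qed.

(** * Martingale increments and influences *)

Definition average (i : 'I_n) (g : cube n -> R) : cube n -> R :=
  fun x => (g x + g (flip i x)) / 2.

Definition derivative (i : 'I_n) (g : cube n -> R) : cube n -> R :=
  fun x => (g x - g (flip i x)) / 2.

Lemma coef_flip (i : 'I_n) (g : cube n -> R) S :
  coef (fun x => g (flip i x)) S = (-1) ^+ (i \in S) * coef g S.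
Proof.
rewrite /coef -(mean_flip i) -meanZ; apply: eq_mean => x.
by rewrite flipK character_flip mulrCA.
Qed.

Lemma coef_average (i : 'I_n) (g : cube n -> R) S :
  coef (average i g) S = if i \in S then 0 else coef g S.
Proof.
have -> : coef (average i g) S
    = 2^-1 * (coef g S + coef (fun x => g (flip i x)) S).
  rewrite /coef -meanD -meanZ; apply: eq_mean => x; rewrite /average; ring.
by rewrite coef_flip; case: (i \in S) => /=; field.
Qed.

Lemma coef_derivative (i : 'I_n) (g : cube n -> R) S :
  coef (derivative i g) S = if i \in S then coef g S else 0.
Proof.
have -> : coef (derivative i g) S
    = 2^-1 * (coef g S + (-1) * coef (fun x => g (flip i x)) S).
  rewrite /coef -meanZ -meanD -meanZ; apply: eq_mean => x.
  rewrite /derivative; ring.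
by rewrite coef_flip; case: (i \in S) => /=; field.
Qed.

Lemma average_contraction (i : 'I_n) (g : cube n -> R) :
  E (fun x => `|average i g x|) <= E (fun x => `|g x|).
Proof.
have -> : E (fun x => `|g x|) = E (fun x => 2^-1 * (`|g x| + `|g (flip i x)|)).
  by rewrite meanZ meanD (mean_flip i (fun x => `|g x|)); field.
apply: ler_mean => x; first exact: mu_ge0.
rewrite /average normrM mulrC ger0_norm ?invr_ge0 //.
by rewrite ler_pM2l ?invr_gt0 // ler_normD.
Qed.

(** The martingale increment at time [i]: averaging over the coordinates above
    [i] is the conditional expectation given the coordinates up to [i]. *)
Definition increment (i : 'I_n) (g : cube n -> R) : cube n -> R :=
  foldr average (derivative i g) [seq j : 'I_n <- enum 'I_n | (i < j)%N].

Definition is_top (i : 'I_n) (S : {set 'I_n}) :=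
  (i \in S) && [forall j in S, (j <= i)%N].

Lemma coef_increment (i : 'I_n) (g : cube n -> R) S :
  coef (increment i g) S = if is_top i S then coef g S else 0.
Proof.
have foldE s h : coef (foldr average h s) S
    = if has [in S] s then 0 else coef h S.
  by elim: s => //= j s IH; rewrite coef_average IH; case: (j \in S).
rewrite foldE coef_derivative /is_top.
have -> : has [in S] [seq j : 'I_n <- enum 'I_n | (i < j)%N]
    = ~~ [forall j in S, (j <= i)%N].
  rewrite negb_forall; apply/hasP/existsP => [[j]|[j]].
    rewrite mem_filter => /andP[ij _] jS; exists j.
    by rewrite negb_imply -ltnNge ij andbT.
  rewrite negb_imply -ltnNge => /andP[jS ij]; exists j => //.
  by rewrite mem_filter ij mem_enum.
by case: (i \in S); case: [forall _ in _, _].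
Qed.

Lemma increment_contraction (i : 'I_n) (g : cube n -> R) :
  E (fun x => `|increment i g x|) <= E (fun x => `|derivative i g x|).
Proof.
rewrite /increment; elim: [seq _ <- _ | _] => //= j s.
exact: le_trans (average_contraction _ _).
Qed.

(** Each nonempty set has a unique largest element, so the increments split
    the spectrum of [g]. *)
Lemma energy_increments (r : R) (g : cube n -> R) :
  coef g set0 = 0 -> \sum_i energy r (increment i g) = energy r g.
Proof.
move=> g0; rewrite exchange_big; apply: eq_bigr => S _ /=.
have [->|[i0 i0S]] := set_0Vmem S.
  rewrite g0 expr0n mulr0 big1 // => i _.
  by rewrite coef_increment /is_top inE expr0n mulr0.
rewrite -mulr_sumr; congr (_ * _).
case: (@arg_maxnP _ i0 [in S] (@nat_of_ord n) i0S) => i iS imax.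
rewrite (bigD1 i) //= big1 ?addr0 => [|j ji].
  rewrite coef_increment /is_top iS; case: forallP => // -[] j.
  by apply/implyP => /imax.
rewrite coef_increment /is_top; case: andP => [[jS /forallP/(_ i)]|].
  rewrite iS /= => ij; case/eqP: ji; apply/val_inj/eqP.
  by rewrite eqn_leq ij; have /= -> := imax j jS.
by rewrite expr0n.
Qed.

(** Because the second moments of the increments add up to that of [g], summing
    the bounds of the increments by Cauchy-Schwarz never involves the total
    influence, only the sum of squares. *)
Lemma energy_le_influences (g : cube n -> R) : coef g set0 = 0 ->
  energy 3^-1 g ^+ 2
    <= (\sum_i E (fun x => `|derivative i g x|) ^+ 2) * E (fun x => g x ^+ 2).
Proof.
move=> g0; rewrite -energy1 -!(energy_increments _ g0).
apply: sqr_sum_le => i; rewrite ?sqr_ge0 ?energy_ge0 ?ler01 //.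
apply: le_trans (hypercontractivity _) _; rewrite energy1.
apply: ler_wpM2r.
  by apply: mean_ge0 => x; [exact: mu_ge0 | exact: sqr_ge0].
rewrite ler_sqr ?nnegrE; first exact: increment_contraction.
  by apply: mean_ge0 => x; [exact: mu_ge0 | exact: normr_ge0].
by apply: mean_ge0 => x; [exact: mu_ge0 | exact: normr_ge0].
Qed.

(** * Interpolation between noise rates *)

(** Young's inequality between [x^t] and 1 with exponents [1/t], [1/(1-t)]. *)
Lemma powR_le_tangent (x t : R) : 0 <= x -> 0 <= t -> t < 1 ->
  x `^ t <= t * x + (1 - t).
Proof.
move=> x0; rewrite le_eqVlt => /predU1P[<-|t0] t1.
  by rewrite powRr0 mul0r subr0 add0r.
have t1' : 0 < 1 - t by rewrite subr_gt0.
have := @conjugate_powR _ (x `^ t) 1 t^-1 (1 - t)^-1 (powR_ge0 _ _) ler01.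
rewrite !invr_gt0 !invrK => /(_ t0 t1'); rewrite addrC subrK => /(_ erefl).
by rewrite powR1 mulr1 mul1r -powRrM mulfV ?gt_eqF // powRr1 // mulrC.
Qed.

(** Pass through [exp (- eps)], which is [exp (-2)] to the power [eps / 2], and
    use [exp 2 >= 3]. *)
Lemma one_sub_le_powR (eps : R) : 0 <= eps -> 1 - eps <= 3^-1 `^ (eps / 2).
Proof.
move=> e0; apply: (@le_trans _ _ (sequences.expR (- eps))).
  exact: expR_ge1Dx.
rewrite (_ : - eps = (- 2) * (eps / 2)); last by field.
rewrite expRM ge0_ler_powR ?nnegrE ?divr_ge0 ?invr_ge0 ?expR_ge0 //.
rewrite expRN lef_pV2 ?posrE ?expR_gt0 //.
by apply: le_trans (expR_ge1Dx 2); rewrite -natr1 addrC.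
Qed.

(** Jensen for the concave power [t = eps / 2], done by hand: bound
    [(3^-#|S|)^t] by the tangent line at the mean [m = energy 3^-1 g / V] and
    sum against the weights [coef g S ^+ 2]. *)
Lemma energy_interpolation (g : cube n -> R) (eps : R) :
  let V := E (fun x => g x ^+ 2) in
  0 <= eps <= 1 -> 0 < V ->
  energy (1 - eps) g <= V * (energy 3^-1 g / V) `^ (eps / 2).
Proof.
move=> V /andP[e0 e1] V0; set t := eps / 2; set m := _ / V.
have t0 : 0 <= t by rewrite divr_ge0.
have t1 : t < 1 by rewrite /t; lra.
have i3 : 0 < 3^-1 :> R by rewrite invr_gt0.
have m0 : 0 < m.
  rewrite divr_gt0 // lt0r energy_ge0 ?ltW // andbT.
  apply: contraTneq V0 => Q0; rewrite -leNgt /V parseval.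
  rewrite big1 // => S _; apply/eqP.
  have /eqP := Q0; rewrite psumr_eq0 => [/allP/(_ S)|S' _].
    rewrite mem_index_enum => /(_ isT) /=.
    by rewrite mulf_eq0 expf_eq0 gt_eqF // andbF.
  by rewrite mulr_ge0 ?sqr_ge0 // exprn_ge0 // ltW.
have VE : V = \sum_S coef g S ^+ 2 by exact: parseval.
apply: (@le_trans _ _ (\sum_(S : {set 'I_n})
    m `^ t * (t * (3^-1 ^+ #|S| / m) + (1 - t)) * coef g S ^+ 2)).
  apply: ler_sum => S _; apply: ler_wpM2r; first exact: sqr_ge0.
  apply: (@le_trans _ _ ((3^-1 `^ t) ^+ #|S|)).
    apply: lerXn2r; rewrite ?nnegrE ?powR_ge0 ?subr_ge0 //.
    exact: one_sub_le_powR.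
  have p0 : 0 <= 3^-1 ^+ #|S| / m by rewrite mulr_ge0 ?exprn_ge0 ?invr_ge0 ?ltW.
  have -> : (3^-1 `^ t) ^+ #|S| = m `^ t * (3^-1 ^+ #|S| / m) `^ t.
    rewrite -powRM ?(ltW m0) //.
    rewrite [m * _]mulrC divfK ?gt_eqF //.
    by rewrite -powR_mulrn ?powR_ge0 // powRAC powR_mulrn // ltW.
  apply: ler_wpM2l; first exact: powR_ge0.
  by rewrite powR_le_tangent.
rewrite le_eqVlt; apply/orP; left; apply/eqP.
transitivity (m `^ t * (t / m * energy 3^-1 g + (1 - t) * V)).
  rewrite VE /energy.
  rewrite !mulr_sumr -big_split mulr_sumr; apply: eq_bigr => S _ /=; ring.
have -> : energy 3^-1 g = m * V by rewrite /m divfK ?gt_eqF.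
by field; rewrite gt_eqF.
Qed.

End Cube.

(** * Stability and influences of Boolean functions *)

Section Boolean.
Variables (R : realType) (n : nat).
Notation E := (mean (mu R n)).

Lemma noise_sum1 (eps : R) (x : cube n) : \sum_y noise eps x y = 1.
Proof.
rewrite -(bigA_distr_bigA (fun i b => noise_bit eps (x i) b)) big1 // => i _.
by rewrite big_bool /noise_bit; case: (x i) => /=; field.
Qed.

Lemma noise_sym (eps : R) (x y : cube n) : noise eps x y = noise eps y x.
Proof. by apply: eq_bigr => i _; rewrite /noise_bit eq_sym. Qed.

Lemma mean_noisy_pair1 (eps : R) (f : cube n -> R) :
  mean (noisy_pair eps) (fun xy => f xy.1) = E f.
Proof.
transitivity (\sum_x \sum_y mu R n x * noise eps x y * f x).
  by rewrite pair_big.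
apply: eq_bigr => x _; rewrite -mulr_suml -mulr_sumr.
by rewrite noise_sum1 mulr1.
Qed.

Lemma mean_noisy_pair2 (eps : R) (f : cube n -> R) :
  mean (noisy_pair eps) (fun xy => f xy.2) = E f.
Proof.
transitivity (\sum_x \sum_y mu R n x * noise eps x y * f y).
  by rewrite pair_big.
rewrite exchange_big; apply: eq_bigr => y _ /=.
under eq_bigr => x _ do rewrite noise_sym.
by rewrite -mulr_suml -mulr_sumr noise_sum1 mulr1.
Qed.

Lemma stability_energy (eps : R) (f : cube n -> R) :
  stability eps f = energy (1 - eps) (fun x => f x - E f).
Proof.
rewrite /stability /cov mean_noisy_pair1 mean_noisy_pair2.
exact: (noise_energy eps (fun x => f x - E f)).
Qed.

Lemma coef0_centered (f : cube n -> R) : coef (fun x => f x - E f) set0 = 0.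
Proof.
rewrite /coef; transitivity (E f + E (fun=> - E f)).
  rewrite -meanD; apply: eq_mean => x.
  by rewrite /character big_set0 mulr1.
by rewrite mean_cst subrr.
Qed.

(** The derivative of a sign-valued function is 0, 1 or -1, so its modulus is
    the indicator of the event that defines the influence. *)
Lemma derivative_influence (f : cube n -> R) (i : 'I_n) :
  (forall x, f x = -1 \/ f x = 1) ->
  E (fun x => `|derivative i (fun x => f x - E f) x|) = Inf f i.
Proof.
move=> f1; rewrite /Inf /pr /mean [RHS]big_mkcond; apply: eq_bigr => x _ /=.
rewrite /derivative inE.
rewrite (_ : _ - _ - _ = f x - f (flip i x)); last ring.
have N1 : (1 == -1 :> R) = false by apply/eqP; lra.
case: (f1 x) (f1 (flip i x)) => -> [] ->; rewrite ?eqxx ?subrr /=.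
- by rewrite mul0r normr0 mulr0.
- by rewrite eq_sym N1 (_ : (_ / _) = -1); [rewrite normrN1 mulr1|field].
- by rewrite N1 (_ : (_ / _) = 1); [rewrite normr1 mulr1|field].
- by rewrite mul0r normr0 mulr0.
Qed.

(** With [m = E f], [|f - m| = 1 - m f] because [f] is a sign and
    [|m| <= 1], so both sides equal [1 - m^2]. *)
Lemma mean_abs_boolean (f : cube n -> R) : (forall x, f x = -1 \/ f x = 1) ->
  E (fun x => `|f x - E f|) = var (mu R n) f.
Proof.
move=> f1; set m := E f.
have m1 : m <= 1.
  rewrite -[leRHS](mean_cst n); apply: ler_mean => x; first exact: mu_ge0.
  by case: (f1 x) => ->; lra.
have m1' : -1 <= m.
  rewrite -[leLHS](mean_cst n); apply: ler_mean => x; first exact: mu_ge0.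
  by case: (f1 x) => ->; lra.
have lin a b : E (fun x => a + b * f x) = a + b * m.
  by rewrite meanD mean_cst meanZ.
transitivity (1 + (- m) * m).
  rewrite -lin; apply: eq_mean => x; case: (f1 x) => ->.
    rewrite ler0_norm; lra.
  rewrite ger0_norm; lra.
transitivity ((1 + m ^+ 2) + (- (2 * m)) * m); first ring.
rewrite -lin; apply: eq_mean => x; case: (f1 x) => ->; rewrite -/m; ring.
Qed.

End Boolean.

Theorem theorem8 (R : realType) :
  exists C c : R, [/\ 0 < C, 0 < c &
    forall (n : nat) (f : cube n -> R) (eps : R),
      (1 <= n)%N ->
      (forall x : cube n, f x = -1 \/ f x = 1) ->
      0 <= eps <= 1 ->
      stability eps f
        <= C * var (mu R n) f * (\sum_(i < n) Inf f i ^+ 2) `^ (c * eps)].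
Proof.
exists 1, 8^-1; split; rewrite ?invr_gt0 // => n f eps _ f1 e01.
rewrite mul1r stability_energy.
pose g x := f x - mean (mu R n) f; rewrite -/g.
set W := \sum_i _.
have W0 : 0 <= W by apply: sumr_ge0 => i _; exact: sqr_ge0.
have VE : var (mu R n) f = mean (mu R n) (fun x => g x ^+ 2) by [].
have infl : energy 3^-1 g ^+ 2 <= W * var (mu R n) f.
  rewrite VE; apply: le_trans (energy_le_influences (coef0_centered _)) _.
  by under eq_bigr => i _ do rewrite derivative_influence //.
have small : energy 3^-1 g ^+ 2 <= var (mu R n) f ^+ 2 * var (mu R n) f.
  by rewrite -{1}(mean_abs_boolean f1) VE; exact: hypercontractivity.
move: VE infl small; set V := var _ f; set Q := energy 3^-1 g.
move=> VE infl small.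
have V0 : 0 <= V.
  by rewrite VE; apply: mean_ge0 => x; [exact: mu_ge0 | exact: sqr_ge0].
have Q0 : 0 <= Q by apply: energy_ge0; rewrite invr_ge0.
move: V0; rewrite le_eqVlt => /predU1P[V0|V0].
  rewrite -V0 mul0r; move: V0; rewrite VE parseval => /esym/eqP.
  rewrite psumr_eq0 => [/allP g0|S _]; last exact: sqr_ge0.
  rewrite /energy big1 // => S _.
  by have /eqP -> := g0 S (mem_index_enum _); rewrite mulr0.
have VE0 := V0; rewrite VE in VE0.
have := energy_interpolation e01 VE0.
(* [(Q / V)^4 <= W] suffices: it is the product of [infl] and [small] *)
rewrite -VE -/Q => /le_trans; apply; rewrite ler_pM2l //.
have -> : W `^ (8^-1 * eps) = (W `^ (4^-1)) `^ (eps / 2).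
  by rewrite -powRrM; congr (_ `^ _); field.
have m0 : 0 <= Q / V by rewrite divr_ge0 // ltW.
case/andP: e01 => e0 _.
apply: ge0_ler_powR; [exact: divr_ge0 | by [] | exact: powR_ge0 |].
rewrite (_ : Q / V = ((Q / V) ^+ 4) `^ 4^-1); last first.
  by rewrite -powR_mulrn // -powRrM mulfV ?pnatr_eq0 // powRr1.
apply: ge0_ler_powR; rewrite ?nnegrE ?invr_ge0 ?exprn_ge0 //.
rewrite expr_div_n ler_pdivrMr ?exprn_gt0 //.
rewrite (_ : Q ^+ 4 = Q ^+ 2 * Q ^+ 2); last ring.
rewrite (_ : W * V ^+ 4 = (W * V) * (V ^+ 2 * V)); last ring.
by apply: ler_pM; rewrite ?sqr_ge0.
Qed.
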